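(* Let $X$ be a random vector in $\mathbb{R}^p$ and let $Y$ be a random vector in $\mathbb{R}^s$ with range $\Omega_Y$ and distribution $F_Y$. Let $\mathfrak{B}=\{I_B : B \text{ a Borel set in } \Omega_Y\}$ be the family of measurable indicator functions. If $\mathfrak{F}$ is a family of measurable $\mathbb{F}$-valued functions on $\Omega_Y$ ($\mathbb{F}=\mathbb{R}$ or $\mathbb{C}$) that is a subset of $L_2(F_Y)$ and is dense in $\mathfrak{B}$, then $\mathfrak{F}$ characterizes the central subspace, that is, $$\operatorname{span}\{\mathcal{S}_{E[f(Y)|X]} : f\in\mathfrak{F}\}=\mathcal{S}_{Y|X}.$$
   Context: $P_{\mathcal{S}}$ denotes the orthogonal projection of $\mathbb{R}^p$ onto a subspace $\mathcal{S}$. The central subspace $\mathcal{S}_{Y|X}$ is the intersection of all linear subspaces $\mathcal{S}\subseteq\mathbb{R}^p$ such that $Y$ and $X$ are conditionally independent given $P_{\mathcal{S}}X$. For $f$ with $E|f(Y)|<\infty$, the central mean subspace $\mathcal{S}_{E[f(Y)|X]}$ is the intersection of all linear subspaces $\mathcal{S}\subseteq\mathbb{R}^p$ such that $E[f(Y)|X]=E[f(Y)|P_{\mathcal{S}}X]$ (almost surely). Standing assumption: these subspaces are well defined, i.e. each intersection itself satisfies the corresponding defining property. $L_2(F_Y)$ is the class of functions $f(Y)$ with finite variance, with inner product $\langle f_1,f_2\rangle=E[f_1(Y)f_2(Y)]$. ''$\mathfrak{F}$ is dense in $\mathfrak{B}$'' means that for every Borel set $B$ in $\Omega_Y$ there is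 a sequence $f_k\in\mathfrak{F}$ with $E|I_B(Y)-f_k(Y)|^2\to 0$. The span of a collection of subspaces is the smallest linear subspace containing all of them. *)

(* Defs.v *)
From HB Require Import structures.
From mathcomp Require Import all_boot all_order all_algebra.
From mathcomp Require Import all_classical all_reals all_analysis.
From mathcomp Require Import complex.

Set Implicit Arguments.
Unset Strict Implicit.
Unset Printing Implicit Defensive.

Import Order.TTheory GRing.Theory Num.Theory.
Import numFieldNormedType.Exports.

Local Open Scope classical_set_scope.
Local Open Scope ring_scope.

(* R^n as row vectors, with the Borel sigma-algebra of its usual topology. *)
Notation borel_rV R n := (g_sigma_algebraType (@open 'rV[R]_n)).

Section Projection.
Context {R : realType} {n : nat}.
Implicit Types (S : {vspace 'rV[R]_n}) (u v x : 'rV[R]_n).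

Definition dotv u v : R := (u *m v^T) 0 0.

Definition is_orth_proj S x v : Prop :=
  v \in S /\ {in S, forall u, dotv (x - v) u = 0}.

Definition orth_proj S x : 'rV[R]_n := xget 0 [set v | is_orth_proj S x v].

Lemma dotvBl u v x : dotv (u - v) x = dotv u x - dotv v x.
Proof. by rewrite /dotv mulmxBl !mxE. Qed.

Lemma dotv_eq0 u : dotv u u = 0 -> u = 0.
Proof.
rewrite /dotv mxE => /eqP; rewrite psumr_eq0; last first.
  by move=> i _; rewrite mxE -expr2 sqr_ge0.
move=> /allP u0; apply/rowP => i; rewrite mxE; apply/eqP.
have := u0 i (mem_index_enum i).
by rewrite mxE mulf_eq0 orbb.
Qed.

Lemma is_orth_proj_uniq S x v w :
  is_orth_proj S x v -> is_orth_proj S x w -> v = w.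
Proof.
move=> [Sv ov] [Sw ow]; apply/eqP; rewrite -subr_eq0; apply/eqP/dotv_eq0.
have Svw : v - w \in S by rewrite rpredB.
have -> : dotv (v - w) (v - w) = dotv (x - w) (v - w) - dotv (x - v) (v - w).
  by rewrite -dotvBl; congr (dotv _ _); rewrite opprB [RHS]addrC addrA subrK.
by rewrite ov // ow // subrr.
Qed.

Lemma is_orth_proj_ex S x : exists v, is_orth_proj S x v.
Proof.
pose B : 'M[R]_(\dim S, n) := \matrix_i (vbasis S)`_i.
have BS w : w *m B \in S.
  rewrite mulmx_sum_row; apply: rpred_sum => i _; apply: rpredZ.
  by rewrite rowK vbasis_mem // mem_nth // size_tuple.
have SB u : u \in S -> exists w, u = w *m B.
  move=> /coord_vbasis ->; exists (\row_i coord (vbasis S) i u).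
  by rewrite mulmx_sum_row; apply: eq_bigr => i _; rewrite mxE rowK.
have BBT : B *m B^T \in unitmx.
  rewrite -row_free_unit -kermx_eq0; apply/rowV0P => w /sub_kermxP wB.
  have /freeP Bfree := basis_free (vbasisP S).
  have /dotv_eq0 wB0 : dotv (w *m B) (w *m B) = 0.
    by rewrite /dotv trmx_mul mulmxA -(mulmxA w) wB mul0mx mxE.
  apply/rowP => i; rewrite [RHS]mxE; apply: (Bfree (fun i => w 0 i)).
  by rewrite -[RHS]wB0 mulmx_sum_row; apply: eq_bigr => j _; rewrite rowK.
exists (x *m B^T *m invmx (B *m B^T) *m B); split=> // u /SB[w ->].
rewrite /dotv trmx_mul mulmxA mulmxBl -(mulmxA _ B) -(mulmxA _ (invmx _)).
by rewrite mulVmx // mulmx1 subrr mul0mx mxE.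
Qed.

Lemma orth_projP S x : is_orth_proj S x (orth_proj S x).
Proof.
by rewrite /orth_proj; case: xgetP => // /(_ _ _); have [v] := is_orth_proj_ex S x;
  move=> Sv /(_ v) /(_ Sv).
Qed.

End Projection.

Section ConditionalExpectation.
Context {R : realType} {d} {T : measurableType d} (P : probability T R).
Implicit Types (G : set (set T)) (Z g : T -> R).

Definition is_cond_exp G Z g : Prop :=
  [/\ forall B : set R, measurable B -> G (g @^-1` B),
      P.-integrable setT (EFin \o g) &
      forall A, G A -> (\int[P]_(w in A) (g w)%:E = \int[P]_(w in A) (Z w)%:E)%E].

(* A version of E[Z | G], for a sub-sigma-algebra G and an integrable Z; it is *)
(* determined only up to a P-null set.                                        *)
Definition cond_exp G Z : T -> R := xget (cst 0) [set g | is_cond_exp G Z g].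

Definition cond_expC G (Z : T -> R[i]) (w : T) : R[i] :=
  (cond_exp G (fun w' => complex.Re (Z w')) w
   +i* cond_exp G (fun w' => complex.Im (Z w')) w)%C.

Definition cond_prob G (A : set T) : T -> R := cond_exp G (\1_A).

Definition cond_indep d1 d2 d3 (T1 : measurableType d1) (T2 : measurableType d2)
    (T3 : measurableType d3) (U : T -> T1) (V : T -> T2) (W : T -> T3) : Prop :=
  let G := g_sigma_algebra_preimage W in
  forall (A : set T1) (B : set T2), measurable A -> measurable B ->
  {ae P, forall w, cond_prob G (U @^-1` A `&` V @^-1` B) w =
                   cond_prob G (U @^-1` A) w * cond_prob G (V @^-1` B) w}.

End ConditionalExpectation.

Section Subspaces.
Context {R : realType} {n : nat}.

Definition vspace_bigcap (D : {vspace 'rV[R]_n} -> Prop) : set 'rV[R]_n :=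
  \bigcap_(S in [set S | D S]) [set` S].

(* The intersection defined by D is itself a subspace satisfying D. *)
Definition bigcap_well_defined (D : {vspace 'rV[R]_n} -> Prop) : Prop :=
  exists2 S, D S & [set` S] = vspace_bigcap D.

(* The smallest linear subspace containing every member of C. *)
Definition span_subspaces (C : set (set 'rV[R]_n)) : set 'rV[R]_n :=
  vspace_bigcap (fun S => forall V, C V -> V `<=` [set` S]).

End Subspaces.

Section CentralSubspaces.
Context {R : realType} {d} {T : measurableType d} (P : probability T R).
Context {p s : nat} (X : T -> borel_rV R p) (Y : T -> borel_rV R s).
Implicit Type S : {vspace 'rV[R]_p}.

Definition proj_rv S : T -> borel_rV R p := fun w => orth_proj S (X w).

(* S is a sufficient dimension reduction subspace. *)
Definition sdr S : Prop := cond_indep P Y X (proj_rv S).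

Definition central_subspace : set 'rV[R]_p := vspace_bigcap sdr.

Definition mean_sdr (f : 'rV[R]_s -> R) S : Prop :=
  {ae P, forall w,
     cond_exp P (g_sigma_algebra_preimage X) (fun w' => f (Y w')) w =
     cond_exp P (g_sigma_algebra_preimage (proj_rv S)) (fun w' => f (Y w')) w}.

Definition central_mean_subspace (f : 'rV[R]_s -> R) : set 'rV[R]_p :=
  vspace_bigcap (mean_sdr f).

Definition mean_sdrC (f : 'rV[R]_s -> R[i]) S : Prop :=
  {ae P, forall w,
     cond_expC P (g_sigma_algebra_preimage X) (fun w' => f (Y w')) w =
     cond_expC P (g_sigma_algebra_preimage (proj_rv S)) (fun w' => f (Y w')) w}.

Definition central_mean_subspaceC (f : 'rV[R]_s -> R[i]) : set 'rV[R]_p :=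
  vspace_bigcap (mean_sdrC f).

End CentralSubspaces.

Section FunctionsOfY.
Context {R : realType} {d} {T : measurableType d} (P : probability T R).
Context {s : nat} (Y : T -> borel_rV R s) (D : set 'rV[R]_s).

(* The range D of Y need not be a Borel set, so the Borel sets in D are the   *)
(* traces on D of Borel sets; the library's measurable_fun D f would hold     *)
(* vacuously for a non-measurable D.                                          *)
Definition borel_in : set (set 'rV[R]_s) :=
  strace (@measurable _ (borel_rV R s)) D.

Definition measurable_in (f : 'rV[R]_s -> R) : Prop :=
  preimage_set_system D f measurable `<=` borel_in.

Definition measurable_inC (f : 'rV[R]_s -> R[i]) : Prop :=
  measurable_in (fun y => complex.Re (f y)) /\
  measurable_in (fun y => complex.Im (f y)).

Definition L2 (f : 'rV[R]_s -> R) : Prop :=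
  measurable_in f /\ (\int[P]_w (`|f (Y w)| ^+ 2)%:E < +oo)%E.

(* The modulus of z : R[i] is the element `|z| of R[i], with real part in R. *)
Definition L2C (f : 'rV[R]_s -> R[i]) : Prop :=
  measurable_inC f /\ (\int[P]_w (complex.Re `|f (Y w)| ^+ 2)%:E < +oo)%E.

Definition dense_in_indicators (F : set ('rV[R]_s -> R)) : Prop :=
  forall B, borel_in B ->
  exists2 f : nat -> 'rV[R]_s -> R, (forall k, F (f k)) &
    (\int[P]_w (`|\1_B (Y w : 'rV[R]_s) - f k (Y w)| ^+ 2)%:E)%E
      @[k --> \oo] --> 0%E.

Definition dense_in_indicatorsC (F : set ('rV[R]_s -> R[i])) : Prop :=
  forall B, borel_in B ->
  exists2 f : nat -> 'rV[R]_s -> R[i], (forall k, F (f k)) &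
    (\int[P]_w
       (complex.Re `|(\1_B (Y w : 'rV[R]_s))%:C%C - f k (Y w)| ^+ 2)%:E)%E
      @[k --> \oo] --> 0%E.

End FunctionsOfY.

(* Main.v *)
From HB Require Import structures.
Require Import Defs.
From mathcomp Require Import all_boot all_order all_algebra.
From mathcomp Require Import all_classical all_reals all_analysis.
From mathcomp Require Import complex measurable_realfun.
From mathcomp Require Import lra.

Set Implicit Arguments.
Unset Strict Implicit.
Unset Printing Implicit Defensive.

Import Order.TTheory GRing.Theory Num.Theory.
Import numFieldNormedType.Exports.

Local Open Scope classical_set_scope.
Local Open Scope ring_scope.

(** For a subspace [S] write [G_S] for the sigma-algebra generated by the
    projection [P_S X], and let [H] and [K] be those of [X] and [Y].  Both kinds
    of subspaces are described by one notion: [G] is sufficient in [H] for an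
    integrable [Z] when E[Z | G] integrates like [Z] over every event of [H];
    for [G] contained in [H], as all [G_S] are, this means that
    E[Z | H] = E[Z | G] almost surely ([sufficientP]).

    - [S] satisfies the condition defining the central mean subspace of [f]
      exactly when [G_S] is sufficient in [H] for [f(Y)] ([mean_sdrP]).
    - [Y] and [X] are conditionally independent given [P_S X] exactly when [G_S]
      is sufficient in [H] for every integrable [K]-measurable variable, and the
      indicators of events of [K] are enough ([cond_indep_sufficient],
      [sufficient_cond_indep]).

    Hence the central subspace has the property defining the central mean
    subspace of each [f], which gives one inclusion.  For the other one, let a
    subspace [S] contain the central mean subspaces of all [f] in the family.
    Sufficiency passes from a sigma-algebra to any larger one between it and [H]
    ([sufficient_mono]), so that [G_S] is sufficient for every [f(Y)]; it passes
    to limits in L1, since conditional expectation is a contraction there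
    ([sufficient_lim]), so by density [G_S] is sufficient for every indicator
    of an event of [K].  Thus [Y] and [X] are conditionally independent given
    [P_S X], and [S] contains the central subspace.

    All facts about products rest on one orthogonality principle
    ([Rintegral_mul_eq0]): a variable whose integral vanishes over each event of
    [G] is orthogonal to every [G]-measurable function.  Conditional
    expectations exist by the Radon-Nikodym theorem ([is_cond_exp_exists]).
    For complex functions, conditional expectation acts on real and imaginary
    parts, and the real parts of an approximating sequence already approximate
    an indicator. *)

(** * Functions measurable for a sub-sigma-algebra, and integrals over its events *)

Section CondExp.
Context {R : realType} {d} {T : measurableType d} (P : probability T R).
Implicit Types (G H : set (set T)) (Z g u b : T -> R).

Definition sub_sigma_algebra G : Prop := sigma_algebra setT G /\ G `<=` measurable.

Definition fun_measurable G g : Prop :=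
  forall B : set R, measurable B -> G (g @^-1` B).

Local Notation integrable g := (P.-integrable setT (EFin \o g)).

Lemma sigma_setT G : sigma_algebra setT G -> G setT.
Proof. by case=> G0 GC _; rewrite -[setT]setD0; exact: GC. Qed.

Lemma sigma_setI G A B : sigma_algebra setT G -> G A -> G B -> G (A `&` B).
Proof.
move=> sG; have mG := measurable_g_measurableTypeE sG.
by rewrite -{1 2 3}mG => mA mB; exact: measurableI.
Qed.

(** Gives access to the library of measurable functions: the type
    [g_sigma_algebraType G] is [T] with [G] as its measurable sets. *)
Lemma fun_measurableP G g : sigma_algebra setT G ->
  fun_measurable G g <->
  measurable_fun setT (g : g_sigma_algebraType G -> R).
Proof.
move=> sG; have mG := measurable_g_measurableTypeE sG.
split=> [mg _ B mB|mg B mB]; first by rewrite setTI mG; exact: mg.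
by have := mg measurableT B mB; rewrite setTI mG.
Qed.

Lemma fun_measurableM G g h : sigma_algebra setT G ->
  fun_measurable G g -> fun_measurable G h ->
  fun_measurable G (fun w => g w * h w).
Proof.
move=> sG /(fun_measurableP _ sG) mg /(fun_measurableP _ sG) mh.
by apply/(fun_measurableP _ sG); exact: measurable_funM.
Qed.

Lemma fun_measurableB G g h : sigma_algebra setT G ->
  fun_measurable G g -> fun_measurable G h ->
  fun_measurable G (fun w => g w - h w).
Proof.
move=> sG /(fun_measurableP _ sG) mg /(fun_measurableP _ sG) mh.
by apply/(fun_measurableP _ sG); exact: measurable_funB.
Qed.

Lemma fun_measurable_measurable G g : sub_sigma_algebra G -> fun_measurable G g ->
  measurable_fun setT g.
Proof. by move=> [_ GT] mg _ B mB; rewrite setTI; apply/GT/mg. Qed.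

Lemma integrable_measurable g : integrable g -> measurable_fun setT g.
Proof. by move=> /(measurable_int P) /measurable_EFinP. Qed.

Lemma integrable_contractM b u : measurable_fun setT b -> (forall w, `|b w| <= 1) ->
  integrable u -> integrable (fun w => b w * u w).
Proof.
move=> mb b1 iu; apply: le_integrable (iu) => //.
  apply/measurable_EFinP; apply: measurable_funM => //.
  exact: integrable_measurable iu.
by move=> w _ /=; rewrite lee_fin normrM ler_piMl.
Qed.

Lemma integrable_indicM A u : measurable A -> integrable u ->
  integrable (fun w => \1_A w * u w).
Proof.
move=> mA; apply: integrable_contractM => [|w]; first exact: measurable_indic.
by rewrite indicE normr_nat lern1 leq_b1.
Qed.

Lemma integrableB_EFin u v : integrable u -> integrable v ->
  integrable (fun w => u w - v w).
Proof.
move=> iu iv.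
exact: (@integrableB _ _ _ P setT measurableT (EFin \o u) (EFin \o v)).
Qed.

Lemma Rintegral_EFin A u : measurable A -> integrable u ->
  (\int[P]_(w in A) u w)%:E = (\int[P]_(w in A) (u w)%:E)%E.
Proof.
move=> mA iu; rewrite /Rintegral fineK//; apply: integrable_fin_num => //.
exact: integrableS iu.
Qed.

Lemma Rintegral_indicM A u :
  \int[P]_(w in A) u w = \int[P]_w (\1_A w * u w).
Proof.
rewrite Rintegral_mkcond; apply: eq_Rintegral => w _.
by rewrite /restrict /patch indicE; case: ifP; rewrite ?mul1r ?mul0r.
Qed.

Lemma Rintegral_eq0_ae u : integrable u -> (forall w, 0 <= u w) ->
  \int[P]_w u w = 0 -> {ae P, forall w, u w = 0}.
Proof.
move=> iu u0 h; have mu := measurable_int P iu.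
have : (\int[P]_w `|(EFin \o u) w| = 0)%E.
  transitivity ((\int[P]_w u w)%:E); last by rewrite h.
  rewrite Rintegral_EFin//; apply: eq_integral => w _ /=.
  by rewrite ger0_norm.
move/(ae_eq_integral_abs P measurableT mu); apply: filterS => w /(_ I) /=.
by case.
Qed.

Lemma ae_eq_Rintegral A u v : measurable A -> measurable_fun setT u ->
  measurable_fun setT v -> {ae P, forall w, u w = v w} ->
  \int[P]_(w in A) u w = \int[P]_(w in A) v w.
Proof.
move=> mA mu mv uv; rewrite /Rintegral; congr fine; apply: ae_eq_integral => //.
- by apply/measurable_EFinP; apply: measurable_funTS.
- by apply/measurable_EFinP; apply: measurable_funTS.
- by apply: filterS uv => w -> _.
Qed.

Lemma normr_Rintegral_le A u : measurable A -> integrable u ->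
  `|\int[P]_(w in A) u w| <= \int[P]_w `|u w|.
Proof.
move=> mA iu; rewrite Rintegral_indicM.
have i1 := integrable_indicM mA iu.
apply: le_trans (le_normr_Rintegral measurableT i1) _.
apply: le_Rintegral => //.
- exact: (@integrable_abse _ _ _ _ _ _ i1).
- exact: (@integrable_abse _ _ _ _ _ _ iu).
- by move=> w _; rewrite normrM indicE normr_nat ler_piMl// lern1 leq_b1.
Qed.

(** * Orthogonality to the functions of a sub-sigma-algebra *)

Import HBNNSimple.
(** A nonnegative [b] is an increasing limit of simple functions, each a
    combination of indicators of events of [G]; dominated convergence applies
    because the approximations times [u] stay below [b * u] in absolute value. *)
Lemma Rintegral_mul_eq0_nneg G u b : sub_sigma_algebra G ->
  integrable u -> (forall A, G A -> \int[P]_(w in A) u w = 0) ->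
  fun_measurable G b -> (forall w, 0 <= b w) ->
  integrable (fun w => b w * u w) ->
  \int[P]_w (b w * u w) = 0.
Proof.
move=> [sG GT] iu u0 mb b0 ibu.
have mb' : measurable_fun setT (EFin \o b : g_sigma_algebraType G -> \bar R).
  by apply/measurable_EFinP/fun_measurableP.
pose bn := nnsfun_approx (@measurableT _ _) mb'.
have mbn n : fun_measurable G (bn n).
  by apply/fun_measurableP.
have mbnT n : measurable_fun setT (bn n : T -> R).
  by apply: fun_measurable_measurable (mbn n); split.
have f0 (x : g_sigma_algebraType G) : setT x -> (0 <= (EFin \o b) x)%E.
  by move=> _; rewrite lee_fin.
have bnb w : bn n w @[n --> \oo] --> b w.
  have := @cvg_nnsfun_approx _ _ _ _ measurableT _ mb' f0 w I.
  by move=> /fine_cvgP[_ h].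
have bn_le n w : bn n w <= b w.
  rewrite -(cvg_lim (@Rhausdorff R) (bnb w)).
  apply: (@nondecreasing_cvgn_le _ (bn ^~ w)); last by apply/cvg_ex; exists (b w).
  move=> i j ij; have /lefP := nd_nnsfun_approx (@measurableT _ _) mb' ij.
  exact.
have iGu A : G A -> integrable (fun w => \1_A w * u w).
  by move=> /GT mA; exact: integrable_indicM.
have bnu0 n : \int[P]_w (bn n w * u w) = 0.
  (* A simple function is the sum of its values times the indicators of its
     level sets, which belong to G. *)
  transitivity (\int[P]_w (\sum_(y <- finmap.enum_fset (fset_set (range (bn n))))
     (y * (\1_(bn n @^-1` [set y]) w * u w)))).
    apply: eq_Rintegral => w _; rewrite {1}fimfunE fsbig_finite//= mulr_suml.
    by apply: eq_bigr => y _; rewrite mulrA.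
  have Gy y : G (bn n @^-1` [set y]) by apply: mbn.
  rewrite /Rintegral.
  have -> : (fun w => (\sum_(y <- finmap.enum_fset (fset_set (range (bn n))))
     (y * (\1_(bn n @^-1` [set y]) w * u w)))%:E) =
     (fun w => \sum_(y <- finmap.enum_fset (fset_set (range (bn n))))
     (y%:E * (\1_(bn n @^-1` [set y]) w * u w)%:E))%E.
    by apply/funext => w; rewrite -sumEFin.
  rewrite integral_sum//; last first.
    move=> y; apply: integrableZl => //; exact: iGu.
  rewrite big1// => y _.
  rewrite integralZl//; last exact: iGu.
  rewrite -(fineK (integrable_fin_num _ (iGu _ (Gy y))))//.
  by have := u0 _ (Gy y); rewrite Rintegral_indicM /Rintegral => ->; rewrite mule0.
have mu := integrable_measurable iu.
have := @dominated_convergence _ _ _ P setT measurableT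
  (fun n w => (bn n w * u w)%:E) (fun w => (b w * u w)%:E)
  (fun w => `|(b w * u w)%:E|%E).
case.
- by move=> n; apply/measurable_EFinP; exact: measurable_funM.
- exact: measurable_int ibu.
- apply: nearW => w _.
  apply/fine_cvgP; split; first exact: nearW.
  exact: cvgMr_tmp (bnb w).
- exact: integrable_abse ibu.
- apply: nearW => w n _; rewrite /= lee_fin !normrM ler_wpM2r//.
  by rewrite !ger0_norm ?bn_le//.
move=> _ _.
have -> : (fun n => \int[P]_w (bn n w * u w)%:E)%E = cst 0%E.
  apply/funext => n; have := bnu0 n; rewrite /Rintegral => /= h.
  rewrite -[LHS]fineK ?h//; apply: integrable_fin_num => //.
  apply: le_integrable (ibu) => //.
    by apply/measurable_EFinP; exact: measurable_funM.
  move=> w _ /=; rewrite lee_fin !normrM ler_wpM2r// !ger0_norm ?bn_le//.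
move=> /cvg_lim; rewrite lim_cst// => /(_ (@ereal_hausdorff R)).
by rewrite /Rintegral => <-.
Qed.

(** Only the product is assumed integrable, so that the lemma serves both for a
    bounded [b] and for a bounded [u]. *)
Lemma Rintegral_mul_eq0 G u b : sub_sigma_algebra G ->
  integrable u -> (forall A, G A -> \int[P]_(w in A) u w = 0) ->
  fun_measurable G b -> integrable (fun w => b w * u w) ->
  \int[P]_w (b w * u w) = 0.
Proof.
move=> sG iu u0 mb ibu.
have mbp (f : T -> R) : fun_measurable G f -> fun_measurable G f^\+.
  have [sG' _] := sG.
  move=> /(fun_measurableP _ sG') mf; apply/(fun_measurableP _ sG').
  exact: measurable_funrpos.
have mNb : fun_measurable G (\- b).
  have [sG' _] := sG.
  move: mb => /(fun_measurableP _ sG') mb; apply/(fun_measurableP _ sG').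
  exact: measurable_funN.
have ip (f : T -> R) : fun_measurable G f -> (forall w, `|f w| = `|b w|) ->
    integrable (fun w => f^\+ w * u w).
  move=> mf fb; apply: le_integrable (ibu) => //.
    apply/measurable_EFinP; apply: measurable_funM; last exact: integrable_measurable iu.
    by apply: fun_measurable_measurable (mbp _ mf).
  move=> w _ /=; rewrite lee_fin !normrM ler_wpM2r// -fb.
  rewrite ger0_norm ?funrpos_ge0// /funrpos; case: (leP (f w) 0) => h//.
  exact: ler_norm.
have ip1 := ip _ mb (fun=> erefl).
have ip2 := ip _ mNb (fun w => normrN (b w)).
have bE : (fun w => b w * u w) = (fun w => b^\+ w * u w - (\- b)^\+ w * u w).
  apply/funext => w; rewrite -mulrBl funrposN; congr (_ * _).
  by have := congr1 (@^~ w) (funrposBneg b).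
have z (f : T -> R) : fun_measurable G f -> integrable (fun w => f^\+ w * u w) ->
    \int[P]_w (f^\+ w * u w) = 0.
  move=> mf if_; apply: Rintegral_mul_eq0_nneg (sG) (iu) u0 (mbp _ mf) _ if_ => w.
  exact: funrpos_ge0.
by rewrite bE RintegralB// !z// subrr.
Qed.

(** * Conditional expectations *)

Lemma is_cond_expP G Z g : sub_sigma_algebra G -> integrable Z ->
  is_cond_exp P G Z g <->
  [/\ fun_measurable G g, integrable g &
    forall A, G A -> \int[P]_(w in A) g w = \int[P]_(w in A) Z w].
Proof.
move=> [_ GT] iZ; split => -[mg ig gZ]; split => // A GA.
  by rewrite /Rintegral gZ.
have mA := GT _ GA.
by rewrite -(Rintegral_EFin mA ig) -(Rintegral_EFin mA iZ) gZ.
Qed.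

Arguments is_cond_expP {G Z g}.

(** Let [G] be the measurable sets of a copy of [T].  The identity transports [P]
    and the charge with density [Z] to that copy, where the charge is absolutely
    continuous; its Radon-Nikodym derivative is [G]-measurable by construction. *)
Lemma is_cond_exp_exists G Z : sub_sigma_algebra G -> integrable Z ->
  exists g, is_cond_exp P G Z g.
Proof.
move=> sG iZ; have [sG' GT] := sG.
have mG := measurable_g_measurableTypeE sG'.
have mid : measurable_fun setT (id : T -> g_sigma_algebraType G).
  by move=> _ B; rewrite setTI mG; exact: GT.
pose Id : {mfun T >-> g_sigma_algebraType G} :=
  HB.pack (id : T -> g_sigma_algebraType G)
   (isMeasurableFun.Build _ _ _ _ _ mid).
pose mu := distribution P Id.
pose nu0 := induced_charge iZ.
pose nu := measure_function_pushforward__canonical__charge_Charge nu0 mid.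
have numu : nu `<< mu.
  apply: (dominates_pushforward (mu := P) (nu := nu0)) => //.
  apply/null_content_dominatesP => A mA PA0.
  change ((\int[P]_(t in A) (Z t)%:E)%E = 0%E); apply: null_set_integral => //.
  exact: measurable_funTS (measurable_int P iZ).
pose h := Radon_Nikodym nu mu.
have ih : mu.-integrable setT h by exact: Radon_Nikodym_integrable.
pose g : T -> R := fine \o h.
have hg w : h w = (g w)%:E.
  by rewrite /g /= fineK// /h Radon_Nikodym_fin_num.
have ig : mu.-integrable setT (EFin \o (g : g_sigma_algebraType G -> R)).
  by apply: eq_integrable ih => // w _; rewrite /= hg.
have mg : fun_measurable G g.
  by apply/(fun_measurableP _ sG')/measurable_EFinP; exact: measurable_int ig.
have mgT := fun_measurable_measurable sG mg.
have ig' : integrable g.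
  apply/integrableP; split; first exact/measurable_EFinP.
  have /integrableP[_] := ig.
  rewrite ge0_integral_pushforward//.
  by apply/measurable_EFinP; apply: measurableT_comp => //; apply/(fun_measurableP _ sG').
exists g; split => // A GA.
have mA := GT _ GA.
have /= := @Radon_Nikodym_integral _ _ _ nu mu A numu.
rewrite mG => /(_ GA); rewrite -/h => hA.
have mphi : measurable_fun setT (Id : T -> g_sigma_algebraType G) by [].
have := @integral_pushforward _ _ _ _ _ _ mphi P A h.
move=> /(_ (measurable_int mu ih)) h1.
have iA : P.-integrable (Id @^-1` A) (h \o Id).
  apply: (eq_integrable mA _ _ _ (integrableS measurableT mA (@subsetT _ _) ig')).
  by move=> w _; exact: esym (hg w).
transitivity (\int[P]_(x in Id @^-1` A) (h \o Id) x)%E.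
  by apply: eq_integral => w _; exact: esym (hg w).
by rewrite -h1 -?hA// mG.
Qed.

Lemma cond_exp_is_cond_exp G Z : sub_sigma_algebra G -> integrable Z ->
  is_cond_exp P G Z (cond_exp P G Z).
Proof.
by move=> sG iZ; have [g hg] := is_cond_exp_exists sG iZ; apply: xgetPex; exists g.
Qed.

Lemma cond_expP G Z : sub_sigma_algebra G -> integrable Z ->
  [/\ fun_measurable G (cond_exp P G Z), integrable (cond_exp P G Z) &
    forall A, G A -> \int[P]_(w in A) cond_exp P G Z w = \int[P]_(w in A) Z w].
Proof.
by move=> sG iZ; have /(is_cond_expP sG iZ) := cond_exp_is_cond_exp sG iZ.
Qed.

(** With [b] the sign of [g], the integral of [b * g] is a difference of integrals
    of [g] over two events of [G], hence equals that of [b * Z], and [b] is bounded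
    by 1 in absolute value. *)
Lemma is_cond_exp_norm_le G Z g : sub_sigma_algebra G -> integrable Z ->
  is_cond_exp P G Z g -> \int[P]_w `|g w| <= \int[P]_w `|Z w|.
Proof.
move=> sG iZ /(is_cond_expP sG iZ)[mg ig gZ]; have [sG' GT] := sG.
pose b w : R := \1_(g @^-1` `[0, +oo[) w - \1_(g @^-1` `]-oo, 0[) w.
have e1 w : (w \in g @^-1` `[0, +oo[) = (0 <= g w).
  by apply/idP/idP; rewrite inE/= in_itv/= andbT.
have e2 w : (w \in g @^-1` `]-oo, 0[) = (g w < 0).
  by apply/idP/idP; rewrite inE/= in_itv.
have bE w : `|g w| = b w * g w.
  by rewrite /b !indicE e1 e2; case: (ger0P (g w)) => _;
    rewrite ?subr0 ?mul1r ?sub0r ?mulN1r.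
have b1 w : `|b w| <= 1.
  rewrite /b !indicE; do 2 case: (_ \in _);
    by rewrite ?subrr ?subr0 ?sub0r ?normrN ?normr1 ?normr0.
have iM (A : set T) v : G A -> integrable v -> integrable (fun w => \1_A w * v w).
  by move=> /GT mA iv; exact: integrable_indicM.
have bM v : integrable v -> integrable (fun w => b w * v w) /\
  \int[P]_w (b w * v w) = \int[P]_(w in g @^-1` `[0, +oo[) v w -
     \int[P]_(w in g @^-1` `]-oo, 0[) v w.
  move=> iv; have -> : (fun w => b w * v w) = (fun w =>
    \1_(g @^-1` `[0, +oo[) w * v w - \1_(g @^-1` `]-oo, 0[) w * v w).
    by apply/funext => w; rewrite mulrBl.
  have i1 := iM _ _ (mg _ (measurable_itv `[0, +oo[)) iv.
  have i2 := iM _ _ (mg _ (measurable_itv `]-oo, 0[)) iv.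
  split; first exact: (integrableB measurableT i1 i2).
  by rewrite (RintegralB measurableT i1 i2) -!Rintegral_indicM.
have [ibZ EbZ] := bM _ iZ; have [ibg Ebg] := bM _ ig.
under eq_Rintegral do rewrite bE.
rewrite Ebg (gZ _ (mg _ (measurable_itv `[0, +oo[))).
rewrite (gZ _ (mg _ (measurable_itv `]-oo, 0[))) -EbZ.
apply: le_Rintegral => //.
  exact: (@integrable_abse _ _ _ _ _ _ iZ).
move=> w _; rewrite (le_trans (ler_norm _))// normrM.
by rewrite ler_piMl.
Qed.

Lemma is_cond_expB G Z Z' g g' : sub_sigma_algebra G -> integrable Z -> integrable Z' ->
  is_cond_exp P G Z g -> is_cond_exp P G Z' g' ->
  is_cond_exp P G (fun w => Z w - Z' w) (fun w => g w - g' w).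
Proof.
move=> sG iZ iZ' /(is_cond_expP sG iZ)[mg ig gZ] /(is_cond_expP sG iZ')[mg' ig' gZ'].
have iB (f h : T -> R) (A : set T) : measurable A -> integrable f -> integrable h ->
    P.-integrable A (EFin \o (fun w => f w - h w)).
  move=> mA ih jh; apply: (@integrableB _ _ _ P A mA (EFin \o f) (EFin \o h)).
    exact: integrableS ih.
  exact: integrableS jh.
have [sG' GT] := sG.
apply/is_cond_expP => //; first exact: iB.
split; [exact: fun_measurableB|exact: iB|move=> A GA].
have mA := GT _ GA.
have iA (f : T -> R) : integrable f -> P.-integrable A (EFin \o f) by exact: integrableS.
by rewrite !RintegralB ?gZ ?gZ'//; exact: iA.
Qed.

(** The difference of two versions is a version for [Z - Z = 0], so the contraction
    in L1 makes its norm vanish. *)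
Lemma is_cond_exp_uniq G Z g g' : sub_sigma_algebra G -> integrable Z ->
  is_cond_exp P G Z g -> is_cond_exp P G Z g' -> {ae P, forall w, g w = g' w}.
Proof.
move=> sG iZ hg hg'.
have hB := is_cond_expB sG iZ iZ hg hg'.
have iZZ := integrableB_EFin iZ iZ.
have /(is_cond_expP sG iZZ)[_ ig _] := hB.
have : {ae P, forall w, `|g w - g' w| = 0}.
  apply: Rintegral_eq0_ae => //; first exact: (@integrable_abse _ _ _ _ _ _ ig).
  apply/eqP; rewrite eq_le Rintegral_ge0// andbT.
  apply: le_trans (is_cond_exp_norm_le sG iZZ hB) _.
  under eq_Rintegral do rewrite subrr normr0.
  by rewrite Rintegral_cst// mul0r.
by apply: filterS => w /normr0_eq0/eqP; rewrite subr_eq0 => /eqP.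
Qed.

(** The contraction in L1 gives that the integral of [`|g|] is at most that of [Z],
    which is the integral of [g]; so [`|g| - g], which is nonnegative, vanishes
    almost everywhere. *)
Lemma is_cond_exp_ge0 G Z g : sub_sigma_algebra G -> integrable Z ->
  (forall w, 0 <= Z w) -> is_cond_exp P G Z g -> {ae P, forall w, 0 <= g w}.
Proof.
move=> sG iZ Z0 hg; have /(is_cond_expP sG iZ)[_ ig gZ] := hg.
have iag : integrable (fun w => `|g w|) by exact: (@integrable_abse _ _ _ _ _ _ ig).
have iB := integrableB_EFin iag ig.
have B0 w : 0 <= `|g w| - g w by rewrite subr_ge0 ler_norm.
have : {ae P, forall w, `|g w| - g w = 0}.
  apply: Rintegral_eq0_ae => //; apply/eqP; rewrite eq_le Rintegral_ge0// andbT.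
  rewrite RintegralB// subr_le0 gZ.
    apply: le_trans (is_cond_exp_norm_le sG iZ hg) _.
    by under eq_Rintegral do rewrite ger0_norm//.
  exact: sigma_setT sG.1.
by apply: filterS => w /eqP; rewrite subr_eq0 => /eqP <-.
Qed.

Lemma is_cond_exp_ae G Z g h : sub_sigma_algebra G -> integrable Z ->
  is_cond_exp P G Z g -> fun_measurable G h -> {ae P, forall w, g w = h w} ->
  is_cond_exp P G Z h.
Proof.
move=> sG iZ /[dup] hg /(is_cond_expP sG iZ)[mg ig gZ] mh gh.
have mgT := fun_measurable_measurable sG mg.
have mhT := fun_measurable_measurable sG mh.
have e (A : set T) : measurable A ->
    (\int[P]_(w in A) (g w)%:E = \int[P]_(w in A) (h w)%:E)%E.
  move=> mA; apply: ae_eq_integral => //.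
  - by apply/measurable_EFinP; apply: measurable_funTS.
  - by apply/measurable_EFinP; apply: measurable_funTS.
  - by apply: filterS gh => w -> _.
have [_ _ gZ'] := hg; have [_ GT] := sG.
split => //; last by move=> A GA; rewrite -gZ'// e//; exact: GT.
apply/integrableP; split; first exact/measurable_EFinP.
have /integrableP[_] := ig; rewrite (_ : \int[P]_x _ = \int[P]_x `|(EFin \o h) x|)%E//.
apply: ae_eq_integral => //.
- by apply: measurableT_comp => //; apply/measurable_EFinP.
- by apply: measurableT_comp => //; apply/measurable_EFinP.
- by apply: filterS gh => w /= -> _.
Qed.

(** The chosen version of a conditional probability lies between 0 and 1 only
    almost everywhere; truncating it gives a version bounded everywhere, whose
    products with integrable functions are then integrable. *)
Lemma cond_prob_version01 G C : sub_sigma_algebra G -> measurable C ->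
  exists c, [/\ is_cond_exp P G (\1_C) c, forall w, 0 <= c w <= 1 &
    {ae P, forall w, cond_prob P G C w = c w}].
Proof.
move=> sG mC; have [sG' GT] := sG.
have i1 : integrable (\1_C) by exact: integrable_indic.
have hg : is_cond_exp P G (\1_C) (cond_prob P G C).
  exact: cond_exp_is_cond_exp.
have /(is_cond_expP sG i1)[mg ig gZ] := hg.
have ic1 : integrable (cst 1) by exact: finite_measure_integrable_cst.
have h1 : is_cond_exp P G (cst 1) (cst 1).
  split => // B mB; rewrite preimage_cst; case: ifP => _; last by case: sG'.
  exact: sigma_setT.
have a1 := is_cond_exp_ge0 sG i1 (fun w => ler0n R (w \in C)) hg.
pose c w : R := Num.max 0 (Num.min (cond_prob P G C w) 1).
have gc : {ae P, forall w, cond_prob P G C w = c w}.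
  have iB := integrableB_EFin ic1 i1.
  have a2 := is_cond_exp_ge0 sG iB _ (is_cond_expB sG ic1 i1 h1 hg).
  have {}a2 : {ae P, forall w, 0 <= cst 1 w - cond_prob P G C w}.
    by apply: a2 => w /=; rewrite subr_ge0 indicE; case: (_ \in _).
  apply: filterS2 a1 a2 => w w0 w1.
  rewrite /c min_l; first by rewrite max_r.
  by move: w1; rewrite subr_ge0.
exists c; split => //.
- apply: is_cond_exp_ae hg _ gc => //.
  have /(fun_measurableP _ sG') mg' := mg.
  apply/(fun_measurableP _ sG').
  apply: measurable_maxr => //; exact: measurable_minr.
- by move=> w; rewrite /c le_max lexx/= ge_max ler01/= ge_min lexx orbT.
Qed.

(** The integrated form of pulling a [G]-measurable factor out of a conditional
    expectation. *)
Lemma Rintegral_mul_cond_exp G Z g b : sub_sigma_algebra G -> integrable Z ->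
  is_cond_exp P G Z g -> fun_measurable G b ->
  integrable (fun w => b w * Z w) -> integrable (fun w => b w * g w) ->
  \int[P]_w (b w * Z w) = \int[P]_w (b w * g w).
Proof.
move=> sG iZ /(is_cond_expP sG iZ)[mg ig gZ] mb ibZ ibg; have [_ GT] := sG.
have ibB : integrable (fun w => b w * (Z w - g w)).
  rewrite (_ : (fun w => _) = (fun w => b w * Z w - b w * g w)).
    exact: integrableB_EFin.
  by apply/funext => w; rewrite mulrBr.
have iB := integrableB_EFin iZ ig.
have : \int[P]_w (b w * (Z w - g w)) = 0.
  apply: (Rintegral_mul_eq0 sG iB _ mb ibB) => A GA; have mA := GT _ GA.
  have iA (f : T -> R) : integrable f -> P.-integrable A (EFin \o f).
    exact: integrableS.
  by rewrite (RintegralB mA (iA _ iZ) (iA _ ig)) gZ// subrr.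
under eq_Rintegral do rewrite mulrBr.
by rewrite (RintegralB measurableT ibZ ibg) => /eqP; rewrite subr_eq0 => /eqP.
Qed.

(** * Sufficiency of a sub-sigma-algebra *)

(** Stated with integrals over events instead of an almost sure equality with
    E[Z | H], which makes it visibly stable under limits in L1. *)
Definition sufficient G H Z : Prop :=
  forall A, H A -> \int[P]_(w in A) Z w = \int[P]_(w in A) cond_exp P G Z w.

(** When [G] is contained in [H], sufficiency says that E[Z | G] is a version of
    E[Z | H], and versions are unique almost surely. *)
Lemma sufficientP G H Z : sub_sigma_algebra G -> sub_sigma_algebra H -> G `<=` H ->
  integrable Z ->
  {ae P, forall w, cond_exp P H Z w = cond_exp P G Z w} <-> sufficient G H Z.
Proof.
move=> sG sH GH iZ; have [_ HT] := sH.
have [mg ig gZ] := cond_expP sG iZ; have [mh ih hZ] := cond_expP sH iZ.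
split=> [hg A HA|sZ].
  rewrite -hZ//; apply: ae_eq_Rintegral hg; first exact: HT.
    exact: fun_measurable_measurable mh.
  exact: fun_measurable_measurable mg.
apply: (is_cond_exp_uniq sH iZ); apply/is_cond_expP => //.
split=> // [B mB|A HA]; last by rewrite sZ.
by apply: GH; exact: mg.
Qed.

(** E[Z | G] is [G']-measurable and integrates like [Z] over the events of [H], in
    particular over those of [G'], so it is also a version of E[Z | G']. *)
Lemma sufficient_mono G G' H Z :
  sub_sigma_algebra G -> sub_sigma_algebra G' ->
  sub_sigma_algebra H -> G `<=` G' -> G' `<=` H -> integrable Z ->
  sufficient G H Z -> sufficient G' H Z.
Proof.
move=> sG sG' sH GG' G'H iZ sZ A HA.
have [mg ig gZ] := cond_expP sG iZ; have [mg' ig' g'Z] := cond_expP sG' iZ.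
have [_ HT] := sH.
rewrite sZ//; apply: ae_eq_Rintegral; first exact: HT.
- exact: fun_measurable_measurable mg.
- exact: fun_measurable_measurable mg'.
apply: (is_cond_exp_uniq sG' iZ); apply/is_cond_expP => //.
split=> // [B mB|B G'B]; first by apply: GG'; exact: mg.
by rewrite sZ//; exact: G'H.
Qed.

(** For [Z'] satisfying the conclusion, the defect of [Z] on an event of [H] is the
    difference of the integrals of [Z - Z'] and of its conditional expectation;
    by the contraction both are at most the distance from [Z] to [Z'] in L1. *)
Lemma sufficient_lim G H Z :
  sub_sigma_algebra G -> sub_sigma_algebra H -> integrable Z ->
  (forall e, 0 < e -> exists Z', [/\ integrable Z', sufficient G H Z' &
     \int[P]_w `|Z w - Z' w| <= e]) ->
  sufficient G H Z.
Proof.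
move=> sG sH iZ approx A HA; have [_ HT] := sH; have mA := HT _ HA.
apply/eqP; rewrite -subr_eq0 -normr_le0; apply/ler_addgt0Pl => e e0; rewrite addr0.
have [Z' [iZ' sZ' le_e]] := approx (e / 2) ltac:(by rewrite divr_gt0).
have hB : is_cond_exp P G (fun w => Z w - Z' w)
    (fun w => cond_exp P G Z w - cond_exp P G Z' w).
  by apply: is_cond_expB => //; exact: cond_exp_is_cond_exp.
have [_ ig _] := cond_expP sG iZ; have [_ ig' _] := cond_expP sG iZ'.
have iA (f : T -> R) : integrable f -> P.-integrable A (EFin \o f).
  exact: integrableS.
have -> : \int[P]_(w in A) Z w - \int[P]_(w in A) cond_exp P G Z w =
   \int[P]_(w in A) (Z w - Z' w) -
   \int[P]_(w in A) (cond_exp P G Z w - cond_exp P G Z' w).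
  rewrite (RintegralB mA (iA _ iZ) (iA _ iZ')) (RintegralB mA (iA _ ig) (iA _ ig')).
  by rewrite (sZ' _ HA) opprB addrA subrK.
have iZZ := integrableB_EFin iZ iZ'.
apply: le_trans (ler_normB _ _) _; rewrite [e]splitr; apply: lerD.
  exact: le_trans (normr_Rintegral_le mA iZZ) le_e.
apply: le_trans (normr_Rintegral_le mA (integrableB_EFin ig ig')) _.
exact: le_trans (is_cond_exp_norm_le sG iZZ hB) le_e.
Qed.

(** * Conditional independence as sufficiency *)

Definition cond_indep_sigma K H G : Prop := forall A C, K A -> H C ->
  {ae P, forall w, cond_prob P G (A `&` C) w = cond_prob P G A w * cond_prob P G C w}.

Lemma normr_le1 (c : T -> R) : (forall w, 0 <= c w <= 1) -> forall w, `|c w| <= 1.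
Proof. by move=> c01 w; have /andP[c0 c1] := c01 w; rewrite ger0_norm. Qed.

(** For [C] in [H] and [c] a version of P(C | G), two uses of the pull-out property
    turn the integral of E[Z | G] over [C] into that of [c * Z].  What remains is
    that [1_C - c] is orthogonal to [Z]; by the orthogonality principle for [K] it
    is enough to integrate it over an event [A] of [K].  There, with [a] a version
    of P(A | G), the integral of [c] over [A] is that of [a * c], which by
    conditional independence is P(A and C). *)
Lemma cond_indep_sufficient K H G Z :
  sub_sigma_algebra K -> sub_sigma_algebra H -> sub_sigma_algebra G ->
  cond_indep_sigma K H G -> fun_measurable K Z -> integrable Z ->
  sufficient G H Z.
Proof.
move=> sK sH sG KHG mZ iZ C HC; have [_ HT] := sH; have mC := HT _ HC.
have [_ KT] := sK.
have [c [hc /normr_le1 c1 pc]] := cond_prob_version01 sG mC.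
have iC : integrable (\1_C) by exact: integrable_indic.
have /(is_cond_expP sG iC)[mc ic _] := hc.
have mcT := fun_measurable_measurable sG mc.
have [mg ig gZ] := cond_expP sG iZ.
have hZ := cond_exp_is_cond_exp sG iZ.
have icZ := integrable_contractM mcT c1 iZ.
have icg := integrable_contractM mcT c1 ig.
have i1Z := integrable_indicM mC iZ.
have i1g := integrable_indicM mC ig.
have swap (f h : T -> R) : (fun w => f w * h w) = (fun w => h w * f w).
  by apply/funext => w; rewrite mulrC.
have -> : \int[P]_(w in C) cond_exp P G Z w = \int[P]_w (c w * Z w).
  rewrite Rintegral_indicM (Rintegral_mul_cond_exp sG iZ hZ mc icZ icg).
  rewrite [in LHS]swap [in RHS]swap.
  apply: (Rintegral_mul_cond_exp sG iC hc mg); by rewrite swap.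
rewrite Rintegral_indicM [in LHS]swap [in RHS]swap.
apply/eqP; rewrite -subr_eq0; apply/eqP.
have iZ1 : integrable (fun w => Z w * \1_C w) by rewrite swap.
have iZc : integrable (fun w => Z w * c w) by rewrite swap.
rewrite -(RintegralB measurableT iZ1 iZc).
under eq_Rintegral do rewrite -mulrBr.
apply: (Rintegral_mul_eq0 sK (integrableB_EFin iC ic)) => //; last first.
  rewrite (_ : (fun w => _) = (fun w => Z w * \1_C w - Z w * c w)).
    exact: integrableB_EFin.
  by apply/funext => w; rewrite mulrBr.
move=> A KA; have mA := KT _ KA.
have iA (f : T -> R) : integrable f -> P.-integrable A (EFin \o f).
  exact: integrableS.
rewrite (RintegralB mA (iA _ iC) (iA _ ic)); apply/eqP; rewrite subr_eq0; apply/eqP.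
have [a [ha /normr_le1 a1 pa]] := cond_prob_version01 sG mA.
have iA1 : integrable (\1_A) by exact: integrable_indic.
have /(is_cond_expP sG iA1)[ma ia _] := ha.
have maT := fun_measurable_measurable sG ma.
rewrite [RHS]Rintegral_indicM [in RHS]swap.
rewrite (Rintegral_mul_cond_exp sG iA1 ha mc);
  [|exact: integrable_contractM|exact: integrable_contractM].
have mAC := measurableI _ _ mA mC.
have iAC : integrable (\1_(A `&` C)) by exact: integrable_indic.
have [mac _ acZ] := cond_expP sG iAC.
transitivity (\int[P]_w cond_prob P G (A `&` C) w).
  rewrite acZ; last exact: sigma_setT sG.1.
  by rewrite Rintegral_indicM; apply: eq_Rintegral => w _; rewrite indicI.
apply: ae_eq_Rintegral => //.
- exact: fun_measurable_measurable mac.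
- exact: measurable_funM.
have := KHG _ _ KA HC; apply: filterS3 pa pc => w -> -> ->.
by rewrite mulrC.
Qed.

(** Let [a] and [c] be bounded versions of P(A | G) and P(C | G).  For [D] in [G],
    pulling out [1_D * a] shows that the integral of [a * c] over [D] is that of [a]
    over the intersection of [C] and [D], an event of [H]; by sufficiency for
    [1_A] this is P(A and C and D).  So [a * c] is a version of P(A and C | G). *)
Lemma sufficient_cond_indep K H G :
  sub_sigma_algebra K -> sub_sigma_algebra H -> sub_sigma_algebra G ->
  G `<=` H -> (forall A, K A -> sufficient G H (\1_A)) -> cond_indep_sigma K H G.
Proof.
move=> [_ KT] sH sG GH sA A C KA HC; have [_ HT] := sH; have [_ GT] := sG.
have mA := KT _ KA; have mC := HT _ HC.
have [a [ha /normr_le1 a1 pa]] := cond_prob_version01 sG mA.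
have [c [hc /normr_le1 c1 pc]] := cond_prob_version01 sG mC.
have iA : integrable (\1_A) by exact: integrable_indic.
have iC : integrable (\1_C) by exact: integrable_indic.
have /(is_cond_expP sG iA)[ma ia _] := ha.
have /(is_cond_expP sG iC)[mc ic _] := hc.
have maT := fun_measurable_measurable sG ma.
have mcT := fun_measurable_measurable sG mc.
have mAC := measurableI _ _ mA mC.
have iAC : integrable (\1_(A `&` C)) by exact: integrable_indic.
have hAC : is_cond_exp P G (\1_(A `&` C)) (cond_prob P G (A `&` C)).
  exact: cond_exp_is_cond_exp.
suff h : is_cond_exp P G (\1_(A `&` C)) (fun w => a w * c w).
  have := is_cond_exp_uniq sG iAC hAC h.
  by apply: filterS3 pa pc => w -> ->.
apply/is_cond_expP => //; split.
- exact: fun_measurableM sG.1 ma mc.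
- exact: integrable_contractM.
move=> D GD; have mD := GT _ GD.
pose b w := \1_D w * a w.
have mb : fun_measurable G b.
  apply: fun_measurableM sG.1 _ ma; apply/(fun_measurableP _ sG.1).
  apply: measurable_indic; by rewrite /measurable/= sigma_algebra_id//; exact: sG.1.
have b1 w : `|b w| <= 1.
  by rewrite normrM mulr_ile1// indicE normr_nat lern1 leq_b1.
have mbT := fun_measurable_measurable sG mb.
rewrite Rintegral_indicM; under eq_Rintegral do rewrite mulrA.
rewrite -(Rintegral_mul_cond_exp sG iC hc mb);
  [|exact: integrable_contractM|exact: integrable_contractM].
transitivity (\int[P]_(w in C `&` D) a w).
  rewrite [RHS]Rintegral_indicM; apply: eq_Rintegral => w _.
  by rewrite indicI /b mulrC mulrA.
transitivity (\int[P]_(w in C `&` D) \1_A w).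
  rewrite (sA _ KA); last by apply: sigma_setI sH.1 HC _; exact: GH.
  apply: ae_eq_Rintegral => //; first exact: measurableI.
    by apply: fun_measurable_measurable (sG) _; have [] := cond_expP sG iA.
  by apply: filterS pa => w.
rewrite [LHS]Rintegral_indicM [RHS]Rintegral_indicM; apply: eq_Rintegral => w _.
by rewrite !indicI /= mulrAC [RHS]mulrC; congr (_ * _); exact: mulrC.
Qed.

End CondExp.
(** * Orthogonal projections are measurable *)

Section OrthProj.
Context {R : realType} {n : nat}.
Implicit Types (S : {vspace 'rV[R]_n}) (x : 'rV[R]_n).

Lemma orth_proj_linear S : linear (orth_proj S).
Proof.
move=> a x y; have [Sx ox] := orth_projP S x; have [Sy oy] := orth_projP S y.
apply: is_orth_proj_uniq (orth_projP S _) _; split=> [|u Su].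
  by rewrite rpredD// rpredZ.
have dotZD (b : R) (v w : 'rV[R]_n) : dotv (b *: v + w) u = b * dotv v u + dotv w u.
  by rewrite /dotv mulmxDl -scalemxAl !mxE.
have -> : a *: x + y - (a *: orth_proj S x + orth_proj S y) =
   a *: (x - orth_proj S x) + (y - orth_proj S y).
  by rewrite scalerBr opprD addrACA.
by rewrite dotZD ox// oy// mulr0 addr0.
Qed.

Lemma orth_proj_sum S x :
  orth_proj S x = \sum_j x 0 j *: orth_proj S ('e_j).
Proof.
pose f : {linear 'rV[R]_n -> 'rV[R]_n} := HB.pack (orth_proj S)
  (GRing.isLinear.Build _ _ _ _ _ (orth_proj_linear S)).
rewrite {1}[x]row_sum_delta -[orth_proj S]/(f : _ -> _) linear_sum.
by apply: eq_bigr => j _; rewrite linearZ.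
Qed.

Lemma orth_proj_continuous S : continuous (orth_proj S).
Proof.
rewrite (_ : orth_proj S = fun x => \sum_j x 0 j *: orth_proj S ('e_j)).
  apply: continuous_big => [|j _ x]; first exact: add_continuous.
  by apply: (@cvgZr_tmp _ _ _ (nbhs x) _ _ _ _ (@coord_continuous R 1 n 0 j x)).
by apply/funext => x; exact: orth_proj_sum.
Qed.

Lemma orth_proj_comp S S' x : (S' <= S)%VS ->
  orth_proj S' (orth_proj S x) = orth_proj S' x.
Proof.
move=> /subvP S'S; apply/esym/(is_orth_proj_uniq (orth_projP S' _)).
have [S1 o1] := orth_projP S' (orth_proj S x); have [S2 o2] := orth_projP S x.
split=> // u S'u.
have -> : x - orth_proj S' (orth_proj S x) =
   (orth_proj S x - orth_proj S' (orth_proj S x)) - (orth_proj S x - x).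
  by rewrite opprB [RHS]addrC subrKA.
have /eqP := o2 u (S'S _ S'u); rewrite dotvBl subr_eq0 => /eqP e.
by rewrite dotvBl o1// dotvBl e !subrr.
Qed.

Lemma measurable_orth_proj S :
  measurable_fun setT (orth_proj S : borel_rV R n -> borel_rV R n).
Proof.
apply: (@measurability _ _ (borel_rV R n) (borel_rV R n) setT (orth_proj S)
  (@open 'rV[R]_n)) => // _ [B oB <-].
rewrite setTI; apply: sub_gen_smallest.
by apply: open_comp => // x _; exact: orth_proj_continuous.
Qed.

End OrthProj.
(** * Sigma-algebras generated by random vectors *)

Section Preimage.
Context {d d'} {T : measurableType d} {T' : measurableType d'}.

Lemma sub_sigma_algebra_preimage (W : T -> T') : measurable_fun setT W ->
  sub_sigma_algebra (g_sigma_algebra_preimage W).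
Proof.
move=> mW; split; first exact/sigma_algebra_preimage/sigma_algebra_measurable.
by move=> _ [B mB <-]; exact: mW.
Qed.

Lemma g_sigma_algebra_preimage_comp d'' (T'' : measurableType d'') (W : T -> T')
    (h : T' -> T'') : measurable_fun setT h ->
  g_sigma_algebra_preimage (h \o W) `<=` g_sigma_algebra_preimage W.
Proof.
move=> mh _ [B mB <-]; exists (h @^-1` B) => //.
by rewrite -[X in measurable X]setTI; exact: mh.
Qed.

End Preimage.

(** * Comparison of L1 and L2 *)

Section SquareIntegrable.
Context {R : realType} {d} {T : measurableType d} (P : probability T R).
Local Notation integrable g := (P.-integrable setT (EFin \o g)).

(** From the pointwise bound [`|u| <= 1 + `|u| ^+ 2], as [P] is finite. *)
Lemma sqr_integrable (u : T -> R) : measurable_fun setT u ->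
  (\int[P]_w (`|u w| ^+ 2)%:E < +oo)%E -> integrable u.
Proof.
move=> mu u2.
have iu2 : integrable (fun w => `|u w| ^+ 2).
  apply/integrableP; split.
    apply/measurable_EFinP/measurable_funX; exact: measurableT_comp.
  rewrite (_ : (\int[P]_x _)%E = (\int[P]_w (`|u w| ^+ 2)%:E)%E)//.
  by apply: eq_integral => w _ /=; rewrite ger0_norm// exprn_ge0.
have i1 : integrable (cst 1) by exact: finite_measure_integrable_cst.
have iB : integrable (fun w => 1 + `|u w| ^+ 2).
  exact: (@integrableD _ _ _ P setT measurableT (EFin \o cst 1)
    (EFin \o (fun w => `|u w| ^+ 2))).
apply: le_integrable iB => //; first exact/measurable_EFinP.
move=> w _ /=; rewrite lee_fin [leRHS]ger0_norm ?addr_ge0 ?exprn_ge0//.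
have := normr_ge0 (u w); nra.
Qed.

(** With [r = e / 2], pointwise [`|u| <= r + r^-1 * `|u| ^+ 2]: the first term
    dominates where [`|u| <= r] and the second one elsewhere.  Each contributes at
    most [e / 2]. *)
Lemma L1_le_L2 (u : T -> R) (e : R) : 0 < e -> integrable u ->
  (\int[P]_w (`|u w| ^+ 2)%:E < ((e / 2) ^+ 2)%:E)%E ->
  \int[P]_w `|u w| <= e.
Proof.
move=> e0 iu u2; pose r := e / 2; have r0 : 0 < r by rewrite divr_gt0.
have mu : measurable_fun setT u by exact: integrable_measurable iu.
have mn : measurable_fun setT (fun w => `|u w|) by exact: measurableT_comp.
have ia : integrable (fun w => `|u w|) by exact: (@integrable_abse _ _ _ _ _ _ iu).
rewrite -lee_fin (Rintegral_EFin measurableT ia).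
have m2 : measurable_fun setT (fun w => (`|u w| ^+ 2)%:E).
  by apply/measurable_EFinP; exact: measurable_funX.
have mr : measurable_fun setT (fun w => (r^-1%:E * (`|u w| ^+ 2)%:E)%E).
  apply: emeasurable_funM => //.
apply: (@le_trans _ _ (\int[P]_w (cst r%:E w + r^-1%:E * (`|u w| ^+ 2)%:E))%E).
  apply: ge0_le_integral => //.
  - exact/measurable_EFinP.
  - exact: emeasurable_funD.
  move=> w _; rewrite -EFinM -EFinD lee_fin.
  have n0 := normr_ge0 (u w).
  have [le_r|lt_r] := leP `|u w| r.
    by rewrite (le_trans le_r)// lerDl mulr_ge0// ?invr_ge0 ?exprn_ge0// ltW.
  apply: (@le_trans _ _ (r^-1 * `|u w| ^+ 2)); last by rewrite lerDr ltW.
  by rewrite ler_pdivlMl// expr2 ler_pM2r ?ltW// (lt_trans r0).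
rewrite ge0_integralD//; last 2 first.
- by move=> w _; rewrite lee_fin ltW.
- by move=> w _; rewrite -EFinM lee_fin mulr_ge0 ?invr_ge0 ?exprn_ge0// ltW.
rewrite integral_cst// [X in (_ * X)%E]probability_setT mule1.
rewrite ge0_integralZl_EFin//; last by rewrite invr_ge0 ltW.
apply: (@le_trans _ _ (r%:E + r^-1%:E * (r ^+ 2)%:E)%E).
  by rewrite leeD2l// lee_pmul2l// ?lte_fin ?invr_gt0//; exact: ltW u2.
by rewrite -EFinM -EFinD lee_fin expr2 mulKf ?gt_eqF// /r -splitr.
Qed.

End SquareIntegrable.

(** * The two reduction conditions as sufficiency *)

Section CentralSubspaceLemmas.
Context {R : realType} {d} {T : measurableType d} (P : probability T R).
Context {p s : nat} (X : {RV P >-> borel_rV R p}) (Y : {RV P >-> borel_rV R s}).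
Context (OmegaY : set 'rV[R]_s) (rangeY : range Y `<=` OmegaY).
Implicit Type (S : {vspace 'rV[R]_p}) (f : 'rV[R]_s -> R).
Local Notation sigma W := (g_sigma_algebra_preimage W).

Lemma measurable_proj_rv S : measurable_fun setT (proj_rv X S).
Proof.
rewrite (_ : proj_rv X S =
  (orth_proj S : borel_rV R p -> borel_rV R p) \o X)//.
by apply: measurableT_comp => //; exact: measurable_orth_proj.
Qed.

Let sX : sub_sigma_algebra (sigma X). Proof. exact: sub_sigma_algebra_preimage. Qed.
Let sY : sub_sigma_algebra (sigma Y). Proof. exact: sub_sigma_algebra_preimage. Qed.
Let sP S : sub_sigma_algebra (sigma (proj_rv X S)).
Proof. exact/sub_sigma_algebra_preimage/measurable_proj_rv. Qed.

Lemma sigma_proj_rv S : sigma (proj_rv X S) `<=` sigma X.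
Proof.
exact: (g_sigma_algebra_preimage_comp (h := orth_proj S : borel_rV R p -> borel_rV R p)
  (measurable_orth_proj S)).
Qed.

Lemma sigma_proj_rvS S S' : (S' <= S)%VS ->
  sigma (proj_rv X S') `<=` sigma (proj_rv X S).
Proof.
move=> SS'; have -> : proj_rv X S' =
    (orth_proj S' : borel_rV R p -> borel_rV R p) \o proj_rv X S.
  by apply/funext => w; rewrite /proj_rv /= orth_proj_comp.
exact: g_sigma_algebra_preimage_comp (measurable_orth_proj S').
Qed.

(** [OmegaY] may fail to be Borel and [f] is controlled on it alone.  A preimage
    under [f] is the trace on [OmegaY] of some Borel set, and since [Y] takes its
    values in [OmegaY] that Borel set has the same preimage under [Y]. *)
Lemma fun_measurable_comp_rv f : measurable_in OmegaY f ->
  fun_measurable (sigma Y) (f \o Y).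
Proof.
move=> mf B mB; have [C mC CE] : borel_in OmegaY (OmegaY `&` f @^-1` B).
  by apply: mf; exists B.
exists C => //; rewrite setTI.
have Yw w : OmegaY (Y w) by apply: rangeY; exists w.
apply/seteqP; split => w /= h.
  by have [] : (OmegaY `&` f @^-1` B) (Y w) by rewrite -CE.
by have [] : (C `&` OmegaY) (Y w) by rewrite CE.
Qed.

Lemma mean_sdrP f S : P.-integrable setT (EFin \o (f \o Y)) ->
  mean_sdr P X Y f S <->
  sufficient P (sigma (proj_rv X S)) (sigma X) (f \o Y).
Proof.
by move=> iZ; exact: (sufficientP (sP S) sX (@sigma_proj_rv S) iZ).
Qed.

Lemma sdrP S :
  sdr P X Y S <-> cond_indep_sigma P (sigma Y) (sigma X) (sigma (proj_rv X S)).
Proof.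
split=> [h A C [A' mA <-] [C' mC <-]|h G A C mA mC].
  by rewrite !setTI; exact: h.
have hA : sigma Y (Y @^-1` A) by exists A => //; rewrite setTI.
have hC : sigma X (X @^-1` C) by exists C => //; rewrite setTI.
exact: h hA hC.
Qed.

Lemma mean_sdrS f S S' : P.-integrable setT (EFin \o (f \o Y)) ->
  (S' <= S)%VS -> mean_sdr P X Y f S' -> mean_sdr P X Y f S.
Proof.
move=> iZ SS' /(mean_sdrP _ iZ) h; apply/mean_sdrP => //.
apply: sufficient_mono h => //; first exact: sigma_proj_rvS.
exact: sigma_proj_rv.
Qed.

Lemma sdr_mean_sdr f S : measurable_in OmegaY f ->
  P.-integrable setT (EFin \o (f \o Y)) -> sdr P X Y S -> mean_sdr P X Y f S.
Proof.
move=> mf iZ /sdrP h; apply/mean_sdrP => //.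
by apply: (cond_indep_sufficient sY) => //; exact: fun_measurable_comp_rv.
Qed.

Lemma mean_sdr_sdr S :
  (forall B, measurable (B : set (borel_rV R s)) -> forall e : R, 0 < e ->
    exists f, [/\ P.-integrable setT (EFin \o (f \o Y)), mean_sdr P X Y f S &
      \int[P]_w `|\1_B (Y w) - f (Y w)| <= e]) ->
  sdr P X Y S.
Proof.
move=> approx; apply/sdrP; apply: sufficient_cond_indep => //; first exact: sigma_proj_rv.
move=> _ [B mB <-]; rewrite setTI.
have mYB : measurable (Y @^-1` B).
  by rewrite -[X in measurable X]setTI; exact: measurable_funPT.
apply: sufficient_lim => //; first exact: integrable_indic.
move=> e e0; have [f [iZ /(mean_sdrP _ iZ) h le_e]] := approx B mB e e0.
by exists (f \o Y).
Qed.

End CentralSubspaceLemmas.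

(** * Spans of families of intersections *)

(** The lattice part of the argument, for arbitrary conditions [D i] and [E] on
    subspaces such that each [D i] is inherited by larger subspaces and [E] holds
    exactly when all the [D i] do.  Well-definedness of [E] makes its minimal
    subspace contain each intersection for [D i]; that of each [D i] makes every
    subspace containing these intersections satisfy [D i]. *)
Lemma span_vspace_bigcap (R : realType) (n : nat) (I : Type) (F : set I)
    (E : {vspace 'rV[R]_n} -> Prop) (D : I -> {vspace 'rV[R]_n} -> Prop) :
  bigcap_well_defined E ->
  (forall i, F i -> bigcap_well_defined (D i)) ->
  (forall i S S', F i -> (S' <= S)%VS -> D i S' -> D i S) ->
  (forall i S, F i -> E S -> D i S) ->
  (forall S, (forall i, F i -> D i S) -> E S) ->
  span_subspaces [set vspace_bigcap (D i) | i in F] = vspace_bigcap E.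
Proof.
move=> [S0 ES0 S0E] wdD Dup ED DE; apply/seteqP; split=> [x xspan|x xE S /= SD].
  rewrite -S0E; apply: xspan => _ [i Fi <-] y; apply; exact: ED.
apply: (xE S); apply: DE => i Fi; have [Si DSi SiE] := wdD i Fi.
apply: Dup DSi => //; apply/subvP => y ySi.
by apply: (SD (vspace_bigcap (D i))); [exists i|rewrite -SiE].
Qed.

Lemma cvge0_lt (R : realType) (u : nat -> \bar R) (e : R) : 0 < e ->
  u @ \oo --> 0%E -> exists k, (u k < e%:E)%E.
Proof.
move=> e0 /fine_cvgP[ufin /cvgr0Pnorm_lt /(_ e e0) ue].
have [k [uk ltk]] := filter_ex (filterI ufin ue).
exists k; rewrite -(fineK uk) lte_fin; exact: le_lt_trans (ler_norm _) ltk.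
Qed.

Lemma normc_sqr (R : realType) (z : R[i]) :
  complex.Re `|z| ^+ 2 = complex.Re z ^+ 2 + complex.Im z ^+ 2.
Proof. by rewrite normc_def /= sqr_sqrtr ?addr_ge0 ?sqr_ge0. Qed.

(** * Families of functions of Y *)

Section Assembly.
Context {R : realType} {d} {T : measurableType d} (P : probability T R).
Context {p s : nat} (X : {RV P >-> borel_rV R p}) (Y : {RV P >-> borel_rV R s}).
Context (OmegaY : set 'rV[R]_s) (rangeY : range Y `<=` OmegaY).

Lemma measurable_comp_rv (f : 'rV[R]_s -> R) : measurable_in OmegaY f ->
  measurable_fun setT (f \o Y).
Proof.
move=> mf; apply: (@fun_measurable_measurable _ _ _ (g_sigma_algebra_preimage Y)).
  exact: sub_sigma_algebra_preimage.
exact: fun_measurable_comp_rv mf.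
Qed.

Lemma L2_integrable f : L2 P Y OmegaY f -> P.-integrable setT (EFin \o (f \o Y)).
Proof. by move=> [mf f2]; apply: sqr_integrable => //; exact: measurable_comp_rv. Qed.

(** The squared modulus is the sum of the squares of the two parts, so it bounds
    each of them. *)
Lemma L2C_ReIm f : L2C P Y OmegaY f ->
  L2 P Y OmegaY (fun y => complex.Re (f y)) /\
  L2 P Y OmegaY (fun y => complex.Im (f y)).
Proof.
move=> [[mr mi] f2].
have mR := measurable_comp_rv mr; have mI := measurable_comp_rv mi.
have mC : measurable_fun setT (fun w => (complex.Re `|f (Y w)| ^+ 2)%:E).
  under eq_fun do rewrite normc_sqr.
  by apply/measurable_EFinP; apply: measurable_funD; apply: measurable_funX.
split; split => //; apply: le_lt_trans f2; apply: ge0_le_integral => //.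
- by apply/measurable_EFinP/measurable_funX; exact: measurableT_comp.
- by move=> w _; rewrite lee_fin normc_sqr real_normK ?num_real// lerDl sqr_ge0.
- by apply/measurable_EFinP/measurable_funX; exact: measurableT_comp.
- by move=> w _; rewrite lee_fin normc_sqr real_normK ?num_real// lerDr sqr_ge0.
Qed.

Lemma integrable_indicB_rv B f : measurable (B : set (borel_rV R s)) ->
  P.-integrable setT (EFin \o (f \o Y)) ->
  P.-integrable setT (EFin \o (fun w => \1_B (Y w) - f (Y w))).
Proof.
move=> mB iZ; apply: integrableB_EFin => //.
have mYB : measurable (Y @^-1` B).
  by rewrite -[X in measurable X]setTI; exact: measurable_funPT.
exact: integrable_indic mYB.
Qed.

Lemma indic_setI_range B w : \1_(B `&` OmegaY) (Y w) = \1_B (Y w) :> R.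
Proof.
have OY : OmegaY (Y w) by apply: rangeY; exists w.
rewrite !indicE; congr (_%:R); congr (nat_of_bool _).
by apply/idP/idP; rewrite !inE => // -[].
Qed.

Lemma mean_sdrC_ReIm f S : mean_sdrC P X Y f S <->
  mean_sdr P X Y (fun y => complex.Re (f y)) S /\
  mean_sdr P X Y (fun y => complex.Im (f y)) S.
Proof.
split=> [h|[hr hi]].
  by split; apply: filterS h => w; rewrite /cond_expC => -[].
by apply: filterS2 hr hi => w hr hi; rewrite /cond_expC hr hi.
Qed.

Lemma span_central_mean_subspace (F : set ('rV[R]_s -> R)) :
  bigcap_well_defined (sdr P X Y) ->
  (forall f, F f -> L2 P Y OmegaY f) ->
  (forall f, F f -> bigcap_well_defined (mean_sdr P X Y f)) ->
  dense_in_indicators P Y OmegaY F ->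
  span_subspaces [set central_mean_subspace P X Y f | f in F] =
  central_subspace P X Y.
Proof.
move=> wd FL2 Fwd dense; apply: span_vspace_bigcap => //.
- by move=> f S S' /FL2/L2_integrable; exact: mean_sdrS.
- move=> f S /FL2 fL2; apply: (sdr_mean_sdr rangeY); first by case: fL2.
  exact: L2_integrable.
move=> S allS; apply: mean_sdr_sdr => B mB e e0.
have [f Ff cvf] := dense (B `&` OmegaY) (ex_intro2 _ _ B mB erefl).
have r0 : 0 < (e / 2) ^+ 2 by rewrite exprn_gt0// divr_gt0.
have [k ltk] := cvge0_lt r0 cvf.
have iZ := L2_integrable (FL2 _ (Ff k)).
exists (f k); split => //; first exact: allS.
apply: L1_le_L2 => //; first exact: integrable_indicB_rv.
by under eq_integral do rewrite -indic_setI_range.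
Qed.

(** An indicator is real, so [1_B(Y)] differs from the real part of [f(Y)] by at
    most its distance to [f(Y)]: the approximation needs only real parts.  The
    imaginary parts enter in the opposite inclusion. *)
Lemma span_central_mean_subspaceC (F : set ('rV[R]_s -> R[i])) :
  bigcap_well_defined (sdr P X Y) ->
  (forall f, F f -> L2C P Y OmegaY f) ->
  (forall f, F f -> bigcap_well_defined (mean_sdrC P X Y f)) ->
  dense_in_indicatorsC P Y OmegaY F ->
  span_subspaces [set central_mean_subspaceC P X Y f | f in F] =
  central_subspace P X Y.
Proof.
move=> wd FL2 Fwd dense; apply: span_vspace_bigcap => //.
- move=> f S S' /FL2/L2C_ReIm[/L2_integrable ir /L2_integrable ii] S'S.
  move=> /mean_sdrC_ReIm[hr hi]; apply/mean_sdrC_ReIm.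
  by split; [exact: mean_sdrS hr|exact: mean_sdrS hi].
- move=> f S /FL2/L2C_ReIm[rL2 iL2] hS; apply/mean_sdrC_ReIm.
  split; apply: (sdr_mean_sdr rangeY) => //; try exact: L2_integrable.
    by case: rL2.
  by case: iL2.
move=> S allS; apply: mean_sdr_sdr => B mB e e0.
have [f Ff cvf] := dense (B `&` OmegaY) (ex_intro2 _ _ B mB erefl).
have r0 : 0 < (e / 2) ^+ 2 by rewrite exprn_gt0// divr_gt0.
have [k ltk] := cvge0_lt r0 cvf.
have [rL2 iL2] := L2C_ReIm (FL2 _ (Ff k)).
have ir := L2_integrable rL2; have ii := L2_integrable iL2.
have [hr _] := (mean_sdrC_ReIm _ _).1 (allS _ (Ff k)).
exists (fun y => complex.Re (f k y)); split => //.
have iB := integrable_indicB_rv mB ir.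
apply: L1_le_L2 => //; apply: le_lt_trans ltk.
(* The imaginary part of the indicator is zero. *)
have zE w : complex.Re `|(\1_(B `&` OmegaY) (Y w : 'rV[R]_s))%:C%C - f k (Y w)| ^+ 2 =
    (\1_B (Y w) - complex.Re (f k (Y w))) ^+ 2 + complex.Im (f k (Y w)) ^+ 2.
  by rewrite normc_sqr raddfB/= indic_setI_range raddfB/= sub0r sqrrN.
apply: ge0_le_integral => //.
- apply/measurable_EFinP/measurable_funX/measurableT_comp => //.
  exact: integrable_measurable iB.
- under eq_fun do rewrite zE.
  apply/measurable_EFinP; apply: measurable_funD; apply: measurable_funX.
    exact: integrable_measurable iB.
  exact: integrable_measurable ii.
by move=> w _; rewrite lee_fin zE real_normK ?num_real// lerDl sqr_ge0.
Qed.

End Assembly.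

Theorem theorem2p1 (R : realType) (d : measure_display) (T : measurableType d)
    (P : probability T R) (p s : nat)
    (X : {RV P >-> borel_rV R p}) (Y : {RV P >-> borel_rV R s})
    (OmegaY : set 'rV[R]_s) (rangeY : range Y `<=` OmegaY)
    (central_wd : bigcap_well_defined (sdr P X Y)) :
  (forall F : set ('rV[R]_s -> R),
     (forall f, F f -> L2 P Y OmegaY f) ->
     (forall f, F f -> bigcap_well_defined (mean_sdr P X Y f)) ->
     dense_in_indicators P Y OmegaY F ->
     span_subspaces [set central_mean_subspace P X Y f | f in F] =
     central_subspace P X Y)
  /\
  (forall F : set ('rV[R]_s -> R[i]),
     (forall f, F f -> L2C P Y OmegaY f) ->
     (forall f, F f -> bigcap_well_defined (mean_sdrC P X Y f)) ->
     dense_in_indicatorsC P Y OmegaY F ->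
     span_subspaces [set central_mean_subspaceC P X Y f | f in F] =
     central_subspace P X Y).
Proof.
split=> F FL2 Fwd dense.
  exact: (span_central_mean_subspace rangeY central_wd FL2 Fwd dense).
exact: (span_central_mean_subspaceC rangeY central_wd FL2 Fwd dense).
Qed.
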